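(* Let $X$ be an infinite set, $\mathcal{Z}$ a bornology on $X$, and $\mathcal{A}\subseteq\mathcal{P}(X)$ with $[X]^{<\omega}\subseteq\mathcal{A}\subseteq\mathcal{Z}$. For $x\in\mathcal{P}(X)$ let $\chi_x\in 2^X$ be the indicator function of $x$ (value $1$ on $x$ and $0$ on $X\setminus x$), and let $\psi:\mathcal{P}(X)\to 2^X$ be given by $\psi(x)=\chi_x$. Then (in $\mathbf{ZF}$): (i) $\psi$ is a $\langle\tau_{\mathcal{P}}[\mathcal{Z}],\tau_2[\mathcal{Z}]\rangle$-continuous bijection. (ii) $\psi$ is a $\langle\tau_{\mathcal{P}}[\mathcal{Z}],\tau_2[\mathcal{Z}]\rangle$-homeomorphism if and only if $X\in\mathcal{Z}$. The spaces $\mathbf{S}_{\mathcal{P}}(X,\mathcal{Z})$ and $2^X[\mathcal{Z}]$ are homeomorphic if and only if $X\in\mathcal{Z}$. (iii) $\psi\upharpoonright\mathcal{A}$ is a homeomorphic embedding of $\mathbf{S}_{\mathcal{A}}(X,\mathcal{Z})$ onto the subspace $\mathbf{S}_{\mathcal{A}}=\{f\in 2^X:f^{-1}[\{1\}]\in\mathcal{A}\}$ of $2^X[\mathcal{Z}]$. (iv) $\psi\upharpoonright[X]^{<\omega}$ is a homeomorphic embedding of $\mathbf{S}(X,\mathcal{Z})$ onto the subspace $\mathbf{S}=\{f\in 2^X:f^{-1}[\{1\}]\in[X]^{<\omega}\}$ of $2^X[\mathcal{Z}]$. (v) If $X$ contains no infinite Dedekind-finite sets (as subsets) and $[X]^{\leq\omega}\subseteq\mathcal{Z}$,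 then $\mathbf{S}$ is a closed subspace of $2^X[\mathcal{Z}]$. (vi) If $X$ contains no infinite quasi Dedekind-finite sets (as subsets) and $\mathcal{Z}$ is a $\sigma$-ideal, then $\mathbf{S}$ is a closed subspace of $2^X[\mathcal{Z}]$.
   Context: The background theory is $\mathbf{ZF}$ (no axiom of choice). $[X]^{<\omega}$, $[X]^{\leq\omega}$ are the sets of finite, respectively countable, subsets of $X$. A bornology on $X$ is an ideal $\mathcal{I}$ of subsets of $X$ (closed under subsets and finite unions, possibly improper) with $\bigcup\mathcal{I}=X$; a $\sigma$-ideal is an ideal closed under unions of sequences indexed by $\omega$. For $\mathcal{A}\subseteq\mathcal{P}(X)$, $\mathbf{S}_{\mathcal{A}}(X,\mathcal{Z})$ is the set $\mathcal{A}$ with the topology $\tau_{\mathcal{A}}[\mathcal{Z}]$ consisting of all $V\subseteq\mathcal{A}$ such that for every $x\in V$ there is $z\in\mathcal{Z}$ with $x\cap z=\emptyset$ and $\{y\in\mathcal{A}:x\subseteq y\subseteq X\setminus z\}\subseteq V$. $\tau_{\mathcal{P}}[\mathcal{Z}]=\tau_{\mathcal{P}(X)}[\mathcal{Z}]$, $\mathbf{S}_{\mathcal{P}}(X,\mathcal{Z})=\mathbf{S}_{\mathcal{P}(X)}(X,\mathcal{Z})$, $\mathbf{S}(X,\mathcal{Z})=\mathbf{S}_{[X]^{<\omega}}(X,\mathcal{Z})$. $2=\{0,1\}$. For $z\in\mathcal{Z}\setminus\{\emptyset\}$ and $p\in 2^z$, $[p]_X=\{f\in 2^X:p\subseteq f\}$.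 $\tau_2[\mathcal{Z}]=\{V\subseteq 2^X:(\forall f\in V)(\exists z\in\mathcal{Z}\setminus\{\emptyset\})(\exists p\in 2^z)\ f\in[p]_X\subseteq V\}$, and $2^X[\mathcal{Z}]=\langle 2^X,\tau_2[\mathcal{Z}]\rangle$. A set $Y$ is Dedekind-finite if there is no injection $\omega\to Y$; it is quasi Dedekind-finite if $[Y]^{<\omega}$ is Dedekind-finite. *)

(* Defs.v *)
Set Implicit Arguments.

(** * Models of first-order ZF

    The theorem is one of ZF without choice, whereas the ambient logic may well
    prove choice for types.  It is therefore stated inside an arbitrary model
    of first-order ZF: every set, function and family below is an element of
    the model, so nothing chosen outside of the model is available in it. *)

(** Formulas in the language {∈, =}, with de Bruijn variables. *)
Inductive form : Type :=
| fMem (i j : nat)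
| fEq (i j : nat)
| fBot
| fImp (p q : form)
| fAnd (p q : form)
| fOr (p q : form)
| fAll (p : form)
| fEx (p : form).

Definition scons (T : Type) (a : T) (e : nat -> T) : nat -> T :=
  fun n => match n with O => a | S k => e k end.

Fixpoint sat (T : Type) (E : T -> T -> Prop) (e : nat -> T) (p : form) : Prop :=
  match p with
  | fMem i j => E (e i) (e j)
  | fEq i j => e i = e j
  | fBot => False
  | fImp p q => sat E e p -> sat E e q
  | fAnd p q => sat E e p /\ sat E e q
  | fOr p q => sat E e p \/ sat E e q
  | fAll p => forall a, sat E (scons a e) p
  | fEx p => exists a, sat E (scons a e) p
  end.

(** In the two schemas the assignment [e] supplies the parameters.  In
    separation, variable 0 is the element; in replacement, variable 0 is the
    argument and variable 1 the value. *)
Record ZF_model : Type := {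
  dom :> Type;
  mem : dom -> dom -> Prop;
  zf_extensionality : forall x y,
    (forall t, mem t x <-> mem t y) -> x = y;
  zf_foundation : forall x, (exists t, mem t x) ->
    exists t, mem t x /\ forall u, mem u t -> ~ mem u x;
  zf_pairing : forall a b, exists c, forall t, mem t c <-> t = a \/ t = b;
  zf_union : forall x, exists u, forall t,
    mem t u <-> exists y, mem y x /\ mem t y;
  zf_powerset : forall x, exists p, forall t,
    mem t p <-> forall u, mem u t -> mem u x;
  zf_infinity : exists w,
    (exists e, (forall t, ~ mem t e) /\ mem e w) /\
    (forall n, mem n w ->
       exists s, (forall t, mem t s <-> mem t n \/ t = n) /\ mem s w);
  zf_separation : forall (p : form) (e : nat -> dom) x, exists y, forall t,
    mem t y <-> mem t x /\ sat mem (scons t e) p;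
  zf_replacement : forall (p : form) (e : nat -> dom) x,
    (forall a b b', mem a x ->
       sat mem (scons a (scons b e)) p ->
       sat mem (scons a (scons b' e)) p -> b = b') ->
    exists y, forall b,
      mem b y <-> exists a, mem a x /\ sat mem (scons a (scons b e)) p
}.

Declare Scope zf_scope.
Notation "x ∈ y" := (mem _ x y) (at level 70, no associativity) : zf_scope.
Notation "x ∉ y" := (~ mem _ x y) (at level 70, no associativity) : zf_scope.
Open Scope zf_scope.

(** * Set-theoretic vocabulary inside a model

    Sets such as P(X), [X]^{<ω}, 2^X, ω and the topologies are given by their
    membership conditions, as predicates on the model.  Functions are sets of
    Kuratowski pairs, that is, elements of the model. *)
Section Vocabulary.
Context {M : ZF_model}.
Implicit Types (x y z t u f g h p n w X Y Z V W : M).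

Definition elts x : M -> Prop := fun t => t ∈ x.

Definition incl x y : Prop := forall t, t ∈ x -> t ∈ y.

Definition disjoint x y : Prop := forall t, t ∈ x -> t ∉ y.

Definition is_empty x : Prop := forall t, t ∉ x.

(** 1 = {0} *)
Definition is_one x : Prop := forall t, t ∈ x <-> is_empty t.

Definition two : M -> Prop := fun t => is_empty t \/ is_one t.

Definition is_pair c x y : Prop := forall t, t ∈ c <-> t = x \/ t = y.

Definition is_opair p x y : Prop :=
  exists u v, is_pair u x x /\ is_pair v x y /\ is_pair p u v.

Definition power X : M -> Prop := fun x => incl x X.

(** f(x) = y *)
Definition app f x y : Prop := exists p, is_opair p x y /\ p ∈ f.

Definition is_fun f (D C : M -> Prop) : Prop :=
  (forall p, p ∈ f -> exists x y, is_opair p x y /\ D x /\ C y) /\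
  (forall x, D x -> exists! y, app f x y).

Definition injection f (D C : M -> Prop) : Prop :=
  is_fun f D C /\ forall x x' y, app f x y -> app f x' y -> x = x'.

Definition bijection f (D C : M -> Prop) : Prop :=
  injection f D C /\ forall y, C y -> exists x, app f x y.

(** g = f ↾ D *)
Definition is_restriction g f (D : M -> Prop) : Prop :=
  forall p, p ∈ g <-> p ∈ f /\ exists x y, is_opair p x y /\ D x.

(** g = f^{-1} as a set of pairs *)
Definition is_inverse g f : Prop :=
  forall p, p ∈ g <->
    exists x y q, is_opair p y x /\ is_opair q x y /\ q ∈ f.

Definition inductive w : Prop :=
  (exists e, is_empty e /\ e ∈ w) /\
  (forall n, n ∈ w -> exists s, (forall t, t ∈ s <-> t ∈ n \/ t = n) /\ s ∈ w).

Definition omega : M -> Prop := fun n => forall w, inductive w -> n ∈ w.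

Definition finite x : Prop :=
  exists n f, omega n /\ bijection f (elts x) (elts n).

Definition infinite x : Prop := ~ finite x.

(** Finite sets are included. *)
Definition countable x : Prop := exists f, injection f (elts x) omega.

(** [X]^{<ω} and [X]^{≤ω} *)
Definition finite_subsets X : M -> Prop := fun x => incl x X /\ finite x.

Definition countable_subsets X : M -> Prop := fun x => incl x X /\ countable x.

Definition dedekind_finite (Y : M -> Prop) : Prop :=
  ~ exists f, injection f omega Y.

Definition quasi_dedekind_finite Y : Prop := dedekind_finite (finite_subsets Y).

(** Improper ideals are allowed. *)
Definition ideal X Z : Prop :=
  (forall z, z ∈ Z -> incl z X) /\
  (forall e, is_empty e -> e ∈ Z) /\
  (forall z y, z ∈ Z -> incl y z -> y ∈ Z) /\
  (forall y z u, y ∈ Z -> z ∈ Z ->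
     (forall t, t ∈ u <-> t ∈ y \/ t ∈ z) -> u ∈ Z).

Definition bornology X Z : Prop :=
  ideal X Z /\ forall t, t ∈ X -> exists z, z ∈ Z /\ t ∈ z.

Definition sigma_ideal X Z : Prop :=
  ideal X Z /\
  forall s, is_fun s omega (elts Z) ->
    forall u, (forall t, t ∈ u <-> exists n z, app s n z /\ t ∈ z) -> u ∈ Z.

(** The underlying set of a space and its family of open sets. *)
Record space : Type := Space { pts : M -> Prop; opn : M -> Prop }.

Definition continuous (T1 T2 : space) f : Prop :=
  is_fun f (pts T1) (pts T2) /\
  forall V, opn T2 V -> exists W, opn T1 W /\
    forall x, x ∈ W <-> pts T1 x /\ exists y, app f x y /\ y ∈ V.

Definition homeomorphism (T1 T2 : space) f : Prop :=
  bijection f (pts T1) (pts T2) /\ continuous T1 T2 f /\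
  exists g, is_inverse g f /\ continuous T2 T1 g.

Definition homeomorphic (T1 T2 : space) : Prop :=
  exists h, homeomorphism T1 T2 h.

(** Meant for S included in the points of T. *)
Definition subspace (T : space) (S : M -> Prop) : space :=
  Space S (fun V => exists W, opn T W /\ forall x, x ∈ V <-> x ∈ W /\ S x).

Definition closed_in (T : space) (S : M -> Prop) : Prop :=
  (forall x, S x -> pts T x) /\
  exists V, opn T V /\ forall x, x ∈ V <-> pts T x /\ ~ S x.

(** The space S_A(X, Z), with topology τ_A[Z]. *)
Definition S_space X Z (A : M -> Prop) : space :=
  Space A (fun V =>
    (forall x, x ∈ V -> A x) /\
    (forall x, x ∈ V -> exists z, z ∈ Z /\ disjoint x z /\
       forall y, A y -> incl x y ->
         (forall t, t ∈ y -> t ∈ X /\ t ∉ z) -> y ∈ V)).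

(** 2^X *)
Definition cantor X : M -> Prop := fun f => is_fun f (elts X) two.

(** [p]_X *)
Definition cylinder X p : M -> Prop := fun f => cantor X f /\ incl p f.

(** The space 2^X[Z], with topology τ_2[Z]. *)
Definition cantor_space X Z : space :=
  Space (cantor X) (fun V =>
    (forall f, f ∈ V -> cantor X f) /\
    (forall f, f ∈ V -> exists z, z ∈ Z /\ ~ is_empty z /\
       exists p, cantor z p /\ cylinder X p f /\
         forall g, cylinder X p g -> g ∈ V)).

(** f = χ_x *)
Definition is_indicator X x f : Prop :=
  cantor X f /\
  forall t, t ∈ X ->
    (t ∈ x -> exists i, is_one i /\ app f t i) /\
    (t ∉ x -> exists o, is_empty o /\ app f t o).

(** psi is the map x |-> χ_x from P(X) to 2^X. *)
Definition is_indicator_map X psi : Prop :=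
  is_fun psi (power X) (cantor X) /\
  forall x f, app psi x f -> is_indicator X x f.

(** {f ∈ 2^X : f^{-1}[{1}] ∈ A} *)
Definition cantor_part X (A : M -> Prop) : M -> Prop :=
  fun f => cantor X f /\
    exists x, A x /\ forall t, t ∈ x <-> exists i, is_one i /\ app f t i.

End Vocabulary.

(* Main.v *)
(** Identify a function of 2^X with the subset of X it indicates.  A set V of
    functions is then open iff each x in V has a nonempty z in Z such that all y
    with y ∩ z = x ∩ z are in V.  Such a neighbourhood contains the basic
    neighbourhood {y : x ⊆ y ⊆ X \ (z \ x)} of S_A(X, Z); conversely
    {y : x ⊆ y ⊆ X \ z} contains {y : y ∩ (x ∪ z) = x}, and x ∪ z is in Z as
    soon as x is.  The point X is isolated in S_P(X, Z), while 2^X[Z] has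
    isolated points only if X is in Z.  Finally, an infinite x contains some c in
    Z (the range of an injection of ω into x, or the union of the range of an
    injection of ω into the finite subsets of x) all of whose supersets are
    infinite, so x has a neighbourhood free of finite sets.

    Separation and replacement are available for first-order formulas only, so
    every predicate fed to them has to be recognised as definable. *)

From Stdlib Require Import Classical PeanoNat Lia.
Require Import Defs.

(** * Definability with parameters *)

Fixpoint ren (f : nat -> nat) (p : form) : form :=
  match p with
  | fMem i j => fMem (f i) (f j)
  | fEq i j => fEq (f i) (f j)
  | fBot => fBot
  | fImp p q => fImp (ren f p) (ren f q)
  | fAnd p q => fAnd (ren f p) (ren f q)
  | fOr p q => fOr (ren f p) (ren f q)
  | fAll p => fAll (ren (scons 0 (fun n => S (f n))) p)
  | fEx p => fEx (ren (scons 0 (fun n => S (f n))) p)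
  end.

(** Assignments are functions that often coincide only pointwise; this takes the place of functional
    extensionality. *)
Lemma sat_ext (T : Type) (E : T -> T -> Prop) (p : form) :
  forall e e', (forall n, e n = e' n) -> (sat E e p <-> sat E e' p).
Proof.
assert (lift : forall (a : T) e e', (forall n, e n = e' n) ->
  forall n, scons a e n = scons a e' n) by (intros a e e' H [|n]; simpl; auto).
induction p as [i j|i j| |p IHp q IHq|p IHp q IHq|p IHp q IHq|p IHp|p IHp];
  intros e e' H; simpl; rewrite ?H; try tauto;
  try (rewrite (IHp e e' H), (IHq e e' H); tauto).
- split; intros h a; [rewrite <- (IHp _ _ (lift a _ _ H))|
    rewrite (IHp _ _ (lift a _ _ H))]; auto.
- split; intros [a h]; exists a; [rewrite <- (IHp _ _ (lift a _ _ H))|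
    rewrite (IHp _ _ (lift a _ _ H))]; auto.
Qed.

Lemma sat_ren (T : Type) (E : T -> T -> Prop) (p : form) :
  forall f e, sat E e (ren f p) <-> sat E (fun n => e (f n)) p.
Proof.
induction p as [i j|i j| |p IHp q IHq|p IHp q IHq|p IHp q IHq|p IHp|p IHp];
  intros f e; simpl; try tauto; try (rewrite IHp, IHq; tauto).
all: assert (H : forall a, sat E (scons a e)
    (ren (scons 0 (fun n => S (f n))) p) <->
    sat E (scons a (fun n => e (f n))) p)
  by (intros a; rewrite IHp; apply sat_ext; intros [|n]; reflexivity).
- split; intros h a; apply H, h.
- split; intros [a h]; exists a; apply H, h.
Qed.

(** The recursion through [scons], rather than a comparison with [k], turns passing under a
    quantifier into a mere conversion in [definable_all] and [definable_ex]. *)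
Fixpoint pre (T : Type) (k : nat) (e rho : nat -> T) : nat -> T :=
  match k with
  | 0 => rho
  | S k => scons (e 0) (pre T k (fun n => e (S n)) rho)
  end.
Arguments pre {T}.

(** A renaming of the parameters alone: the [k] argument slots stay fixed. *)
Fixpoint lift (k : nat) (f : nat -> nat) : nat -> nat :=
  match k with
  | 0 => f
  | S k => scons 0 (fun n => S (lift k f n))
  end.

Lemma pre_lift (T : Type) (k : nat) (f : nat -> nat) (rho : nat -> T) :
  forall e n, pre k e rho (lift k f n) = pre k e (fun m => rho (f m)) n.
Proof. induction k as [|k IH]; intros e [|n]; simpl; auto. Qed.

Lemma pre_ext (T : Type) (k : nat) (rho rho' : nat -> T) :
  (forall n, rho n = rho' n) -> forall e n, pre k e rho n = pre k e rho' n.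
Proof. intros H; induction k as [|k IH]; intros e [|n]; simpl; auto. Qed.

Lemma pre_param (T : Type) (k : nat) (rho : nat -> T) :
  forall e n, pre k e rho (k + n) = rho n.
Proof. induction k as [|k IH]; intros e n; simpl; auto. Qed.

Lemma pre_var (T : Type) (k : nat) (rho : nat -> T) :
  forall e i, i < k -> pre k e rho i = e i.
Proof.
induction k as [|k IH]; intros e [|i] H; simpl; try lia; auto.
apply (IH (fun n => e (S n))); lia.
Qed.

(** The renaming jumps over the [k] slots after the first [j], so a formula in [j] arguments can
    ignore [k] additional ones. *)
Lemma pre_weaken (T : Type) (j k : nat) (rho : nat -> T) :
  forall e n, pre (j + k) e rho (lift j (Nat.add k) n) = pre j e rho n.
Proof.
induction j as [|j IH]; intros e n; simpl; [apply pre_param|].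
destruct n; simpl; auto.
Qed.

(** Two formulas come with separate parameter assignments; spreading these over the even and the odd
    indices lets both formulas read a single assignment. *)
Definition interleave (T : Type) (r1 r2 : nat -> T) (n : nat) : T :=
  if Nat.even n then r1 (Nat.div2 n) else r2 (Nat.div2 n).
Arguments interleave {T}.

Lemma interleave_even (T : Type) (r1 r2 : nat -> T) n :
  interleave r1 r2 (2 * n) = r1 n.
Proof.
unfold interleave; rewrite Nat.even_mul, Nat.div2_double; reflexivity.
Qed.

Lemma interleave_odd (T : Type) (r1 r2 : nat -> T) n :
  interleave r1 r2 (S (2 * n)) = r2 n.
Proof.
unfold interleave.
rewrite Nat.even_succ, Nat.odd_mul, Nat.div2_succ_double; reflexivity.
Qed.

Section Definability.
Context {M : ZF_model}.
Implicit Types (P Q : (nat -> M) -> Prop) (v w : (nat -> M) -> M).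

(** Variables [0], ..., [k - 1] of the formula are the arguments of [P]; all
    further ones are parameters from the model. *)
Definition definable (k : nat) P : Prop :=
  exists p rho, forall e, P e <-> sat (mem M) (pre k e rho) p.

(** The language has no function symbols, so a term is a variable or a parameter. *)
Definition definable_term (k : nat) v : Prop :=
  exists i rho, forall e, v e = pre k e rho i.

Lemma definable_merge k P Q : definable k P -> definable k Q ->
  exists p q rho, (forall e, P e <-> sat (mem M) (pre k e rho) p) /\
    (forall e, Q e <-> sat (mem M) (pre k e rho) q).
Proof.
intros (p & r1 & Hp) (q & r2 & Hq).
exists (ren (lift k (fun n => 2 * n)) p), (ren (lift k (fun n => S (2 * n))) q),
  (interleave r1 r2).
split; intros e; [rewrite Hp|rewrite Hq]; rewrite sat_ren; apply sat_ext;
  intros n; rewrite pre_lift; apply pre_ext; intros m.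
- symmetry; apply interleave_even.
- symmetry; apply interleave_odd.
Qed.

Lemma definable_term_merge k v w : definable_term k v -> definable_term k w ->
  exists i j rho, (forall e, v e = pre k e rho i) /\
    (forall e, w e = pre k e rho j).
Proof.
intros (i & r1 & Hi) (j & r2 & Hj).
exists (lift k (fun n => 2 * n) i), (lift k (fun n => S (2 * n)) j),
  (interleave r1 r2).
split; intros e; [rewrite Hi|rewrite Hj]; rewrite pre_lift; apply pre_ext;
  intros m.
- symmetry; apply interleave_even.
- symmetry; apply interleave_odd.
Qed.

Lemma definable_const k (c : M) : definable_term k (fun _ => c).
Proof.
exists (k + 0), (fun _ => c); intros e; symmetry; apply pre_param.
Qed.

(** The bound is boolean so that the automation can close it by [reflexivity]. *)
Lemma definable_var k i : Nat.ltb i k = true -> definable_term k (fun e => e i).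
Proof.
intros H; apply Nat.ltb_lt in H.
(* Some parameter assignment must be exhibited; infinity shows that the domain is inhabited. *)
destruct (zf_infinity M) as [c _].
exists i, (fun _ => c); intros e; symmetry; apply pre_var; exact H.
Qed.

Lemma definable_mem k v w : definable_term k v -> definable_term k w ->
  definable k (fun e => v e ∈ w e).
Proof.
intros Hv Hw; destruct (definable_term_merge k v w Hv Hw)
  as (i & j & rho & Hi & Hj).
exists (fMem i j), rho; intros e; rewrite Hi, Hj; reflexivity.
Qed.

Lemma definable_eq k v w : definable_term k v -> definable_term k w ->
  definable k (fun e => v e = w e).
Proof.
intros Hv Hw; destruct (definable_term_merge k v w Hv Hw)
  as (i & j & rho & Hi & Hj).
exists (fEq i j), rho; intros e; rewrite Hi, Hj; reflexivity.
Qed.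

Lemma definable_false k : definable k (fun _ => False).
Proof.
destruct (zf_infinity M) as [c _].
exists fBot, (fun _ => c); reflexivity.
Qed.

Lemma definable_imp k P Q : definable k P -> definable k Q ->
  definable k (fun e => P e -> Q e).
Proof.
intros HP HQ; destruct (definable_merge k P Q HP HQ) as (p & q & rho & Hp & Hq).
exists (fImp p q), rho; intros e; simpl; rewrite Hp, Hq; reflexivity.
Qed.

Lemma definable_and k P Q : definable k P -> definable k Q ->
  definable k (fun e => P e /\ Q e).
Proof.
intros HP HQ; destruct (definable_merge k P Q HP HQ) as (p & q & rho & Hp & Hq).
exists (fAnd p q), rho; intros e; simpl; rewrite Hp, Hq; reflexivity.
Qed.

Lemma definable_or k P Q : definable k P -> definable k Q ->
  definable k (fun e => P e \/ Q e).
Proof.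
intros HP HQ; destruct (definable_merge k P Q HP HQ) as (p & q & rho & Hp & Hq).
exists (fOr p q), rho; intros e; simpl; rewrite Hp, Hq; reflexivity.
Qed.

Lemma definable_all k (R : (nat -> M) -> M -> Prop) :
  definable (S k) (fun e => R (fun n => e (S n)) (e 0)) ->
  definable k (fun e => forall a, R e a).
Proof.
intros (p & rho & Hp); exists (fAll p), rho; intros e; simpl.
split; intros H a; apply (Hp (scons a e)); apply H.
Qed.

Lemma definable_ex k (R : (nat -> M) -> M -> Prop) :
  definable (S k) (fun e => R (fun n => e (S n)) (e 0)) ->
  definable k (fun e => exists a, R e a).
Proof.
intros (p & rho & Hp); exists (fEx p), rho; intros e; simpl.
split; intros [a H]; exists a; apply (Hp (scons a e)); apply H.
Qed.

Lemma definable_weaken j k P : definable j P -> definable (j + k) P.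
Proof.
intros (p & rho & Hp); exists (ren (lift j (Nat.add k)) p), rho; intros e.
rewrite Hp, sat_ren; apply sat_ext; intros n; symmetry; apply pre_weaken.
Qed.

Lemma definable_equiv k P Q : (forall e, P e <-> Q e) ->
  definable k P -> definable k Q.
Proof.
intros H (p & rho & Hp); exists p, rho; intros e; rewrite <- H; apply Hp.
Qed.

Lemma definable_term_weaken k v : definable_term k v ->
  definable_term (S k) (fun e => v (fun n => e (S n))).
Proof.
intros (i & rho & Hi); exists (S i), rho; intros e; apply Hi.
Qed.

(** Substituting a term is expressed by an existential equation, so that [R] is only read at the
    newly bound variable 0. *)
Lemma definable_app1 (R : M -> Prop) k v :
  definable 1 (fun e => R (e 0)) -> definable_term k v ->
  definable k (fun e => R (v e)).
Proof.
intros HR Hv.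
apply (definable_equiv k (fun e => exists a, a = v e /\ R a)).
- intros e; split; [intros (a & -> & H); exact H|intros H; eauto].
- apply (definable_ex k (fun e a => a = v e /\ R a)), definable_and.
  + apply definable_eq; [apply definable_var; reflexivity|].
    apply definable_term_weaken, Hv.
  + apply (definable_weaken 1 k _ HR).
Qed.

Lemma definable_app2 (R : M -> M -> Prop) k v w :
  definable 2 (fun e => R (e 0) (e 1)) ->
  definable_term k v -> definable_term k w ->
  definable k (fun e => R (v e) (w e)).
Proof.
intros HR Hv Hw.
(* Binding [b] outside [a] makes [a] variable 0 and [b] variable 1, the slots in which [R] is known
   to be definable. *)
apply (definable_equiv k
  (fun e => exists b a, b = w e /\ a = v e /\ R a b)).
- intros e; split; [intros (b & a & -> & -> & H); exact H|intros H; eauto].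
- apply (definable_ex k (fun e b => exists a, b = w e /\ a = v e /\ R a b)).
  apply (definable_ex (S k) (fun e a => e 0 = w (fun n => e (S n)) /\
    a = v (fun n => e (S n)) /\ R a (e 0))).
  repeat apply definable_and; try apply definable_eq;
    try (apply definable_var; reflexivity).
  + apply (definable_term_weaken (S k) (fun e => w (fun n => e (S n)))).
    apply definable_term_weaken, Hw.
  + apply (definable_term_weaken (S k) (fun e => v (fun n => e (S n)))).
    apply definable_term_weaken, Hv.
  + apply (definable_weaken 2 k _ HR).
Qed.

Definition is_succ (s n : M) : Prop := forall t, t ∈ s <-> t ∈ n \/ t = n.

(** This is x ∩ z = y ∩ z: the indicator functions of x and y lie in the same cylinder over z. *)
Definition agree (z x y : M) : Prop := forall t, t ∈ z -> (t ∈ x <-> t ∈ y).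

End Definability.

(* Automatic recognition of first-order predicates *)
Create HintDb vocabulary.
(* [iff], [not] and [unique] are unfolded as well, because [form] has no connectives for them. *)
#[export] Hint Unfold elts incl disjoint is_empty is_one two is_pair is_opair
  power app is_fun injection bijection is_restriction is_inverse inductive omega
  finite infinite finite_subsets countable dedekind_finite cantor cylinder
  is_indicator cantor_part unique iff not is_succ agree : vocabulary.

Ltac definable_term_tac :=
  first [apply definable_const | apply definable_var; reflexivity].

(** Higher-order patterns expose the outermost connective; the last two branches treat a predicate
    variable whose definability is a hypothesis. *)
Ltac definable_step :=
  match goal with
  | |- definable _ (fun e => _ ∈ _) => apply definable_mem; definable_term_tac
  | |- definable _ (fun e => _ = _) => apply definable_eq; definable_term_tac
  | |- definable _ (fun e => False) => apply definable_false
  | |- definable ?k (fun e => @?P e /\ @?Q e) =>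
      apply (definable_and k P Q); cbv beta
  | |- definable ?k (fun e => @?P e \/ @?Q e) =>
      apply (definable_or k P Q); cbv beta
  | |- definable ?k (fun e => @?P e -> @?Q e) =>
      apply (definable_imp k P Q); cbv beta
  | |- definable ?k (fun e => forall a : dom _, @?R e a) =>
      apply (definable_all k R); cbv beta
  | |- definable ?k (fun e => exists a : dom _, @?R e a) =>
      apply (definable_ex k R); cbv beta
  | H : definable 1 (fun e => ?R (e 0)) |- definable ?k (fun e => ?R (@?v e)) =>
      apply (definable_app1 R k v H); definable_term_tac
  | H : definable 2 (fun e => ?R (e 0) (e 1))
      |- definable ?k (fun e => ?R (@?v e) (@?w e)) =>
      apply (definable_app2 R k v w H); definable_term_tac
  end.

Ltac definability :=
  cbv beta; repeat autounfold with vocabulary; cbv beta; repeat definable_step.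

Section Theory.
Context {M : ZF_model}.
Implicit Types (x y z t u v f g h p q r s k i j o m n w X Y Z U V W a b c d : M).

(** * Sets and functions inside the model *)

Lemma separation (P : M -> Prop) x : definable 1 (fun e => P (e 0)) ->
  exists y, forall t, t ∈ y <-> t ∈ x /\ P t.
Proof.
intros (p & rho & Hp); destruct (zf_separation M p rho x) as [y Hy].
(* Only slot 0 of the assignment is read, so a constant assignment serves. *)
exists y; intros t; rewrite Hy, (Hp (fun _ => t)); reflexivity.
Qed.

Lemma replacement (R : M -> M -> Prop) x :
  definable 2 (fun e => R (e 0) (e 1)) ->
  (forall a b b', a ∈ x -> R a b -> R a b' -> b = b') ->
  exists y, forall b, b ∈ y <-> exists a, a ∈ x /\ R a b.
Proof.
intros (p & rho & Hp) HR.
assert (Hp' : forall a b, R a b <-> sat (mem M) (scons a (scons b rho)) p)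
  by (intros a b; apply (Hp (scons a (fun _ => b)))).
destruct (zf_replacement M p rho x) as [y Hy].
- intros a b b'; rewrite <- !Hp'; apply HR.
- exists y; intros b; rewrite Hy.
  split; intros (a & Ha & H); exists a; rewrite Hp' in *; auto.
Qed.

Lemma empty_exists : exists o : M, is_empty o.
Proof.
destruct (zf_infinity M) as (w & (o & Ho & _) & _); exists o; exact Ho.
Qed.

Lemma empty_unique o o' : is_empty o -> is_empty o' -> o = o'.
Proof.
intros H H'; apply zf_extensionality; intros t; split; intros Ht;
  [destruct (H t Ht)|destruct (H' t Ht)].
Qed.

Lemma one_exists : exists i : M, is_one i.
Proof.
destruct empty_exists as [o Ho].
destruct (zf_pairing M o o) as [i Hi]; exists i; intros t; rewrite Hi.
split; [intros [->| ->]; exact Ho|intros Ht; left; apply empty_unique; auto].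
Qed.

Lemma one_unique i i' : is_one i -> is_one i' -> i = i'.
Proof.
intros H H'; apply zf_extensionality; intros t; rewrite (H t), (H' t); tauto.
Qed.

Lemma one_not_empty i : is_one i -> ~ is_empty i.
Proof.
intros H H'; destruct empty_exists as [o Ho]; apply (H' o), H, Ho.
Qed.

Lemma nonempty_elt x : ~ is_empty x -> exists t, t ∈ x.
Proof.
intros H; apply NNPP; intros H'; apply H; intros t Ht; eauto.
Qed.

Lemma union_exists x y : exists u, forall t, t ∈ u <-> t ∈ x \/ t ∈ y.
Proof.
destruct (zf_pairing M x y) as [c Hc]; destruct (zf_union M c) as [u Hu].
exists u; intros t; rewrite Hu; split.
- intros (v & Hv & Ht); apply Hc in Hv as [->| ->]; auto.
- intros [H|H]; [exists x|exists y]; rewrite Hc; auto.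
Qed.

Lemma insert_exists x a : exists u, forall t, t ∈ u <-> t ∈ x \/ t = a.
Proof.
destruct (zf_pairing M a a) as [c Hc]; destruct (union_exists x c) as [u Hu].
exists u; intros t; rewrite Hu, Hc; tauto.
Qed.

Lemma not_mem_self x : x ∉ x.
Proof.
intros H; destruct (zf_pairing M x x) as [c Hc].
destruct (zf_foundation M c) as (t & Ht & H'); [exists x; apply Hc; auto|].
assert (t = x) as -> by (apply Hc in Ht; tauto).
apply (H' x H), Hc; auto.
Qed.

Lemma not_mem_cycle x y : x ∈ y -> y ∉ x.
Proof.
intros H H'; destruct (zf_pairing M x y) as [c Hc].
destruct (zf_foundation M c) as (t & Ht & H''); [exists x; apply Hc; auto|].
apply Hc in Ht as [->| ->].
- apply (H'' y H'), Hc; auto.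
- apply (H'' x H), Hc; auto.
Qed.

(** Distinct predecessors of one successor would be members of each other, against foundation. *)
Lemma succ_inj s m n : is_succ s m -> is_succ s n -> m = n.
Proof.
intros Hm Hn; apply NNPP; intros Hmn.
assert (H1 : m ∈ s) by (apply Hm; auto).
assert (H2 : n ∈ s) by (apply Hn; auto).
apply Hn in H1 as [H1|H1]; [|auto].
apply Hm in H2 as [H2|H2]; [|auto].
exact (not_mem_cycle m n H1 H2).
Qed.

Lemma succ_unique s s' n : is_succ s n -> is_succ s' n -> s = s'.
Proof.
intros H H'; apply zf_extensionality; intros t; rewrite (H t), (H' t); tauto.
Qed.

Lemma pair_inj c x y x' y' : is_pair c x y -> is_pair c x' y' ->
  (x = x' /\ y = y') \/ (x = y' /\ y = x').
Proof.
intros H H'.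
assert (Hx : x = x' \/ x = y') by (apply H', H; auto).
assert (Hy : y = x' \/ y = y') by (apply H', H; auto).
assert (Hx' : x' = x \/ x' = y) by (apply H, H'; auto).
assert (Hy' : y' = x \/ y' = y) by (apply H, H'; auto).
intuition congruence.
Qed.

Lemma opair_exists x y : exists p, is_opair p x y.
Proof.
destruct (zf_pairing M x x) as [u Hu]; destruct (zf_pairing M x y) as [v Hv].
destruct (zf_pairing M u v) as [p Hp]; exists p, u, v; auto.
Qed.

Lemma opair_unique p p' x y : is_opair p x y -> is_opair p' x y -> p = p'.
Proof.
intros (u & v & Hu & Hv & Hp) (u' & v' & Hu' & Hv' & Hp').
assert (u = u') as <-
  by (apply zf_extensionality; intros t; rewrite (Hu t), (Hu' t); tauto).
assert (v = v') as <-
  by (apply zf_extensionality; intros t; rewrite (Hv t), (Hv' t); tauto).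
apply zf_extensionality; intros t; rewrite (Hp t), (Hp' t); tauto.
Qed.

Lemma opair_inj p x y x' y' : is_opair p x y -> is_opair p x' y' ->
  x = x' /\ y = y'.
Proof.
intros (u & v & Hu & Hv & Hp) (u' & v' & Hu' & Hv' & Hp').
destruct (pair_inj p u v u' v' Hp Hp') as [[-> ->]|[-> ->]].
- destruct (pair_inj u' x x x' x' Hu Hu') as [[-> _]|[-> _]];
    destruct (pair_inj v' x' y x' y' Hv Hv') as [[_ ->]|[E ->]]; auto.
(* Here the singleton of each pair is the unordered pair of the other, so all four coordinates
   coincide. *)
- destruct (pair_inj v' x x x' y' Hu Hv') as [[-> E]|[-> ->]];
    destruct (pair_inj u' _ y x' x' Hv Hu') as [[E' ->]|[E' ->]];
    split; congruence.
Qed.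

(** * The natural numbers of the model *)

Lemma omega_set : exists w : M, forall n, n ∈ w <-> omega n.
Proof.
destruct (zf_infinity M) as (w0 & Hw0).
destruct (separation omega w0) as [w Hw]; [definability|].
exists w; intros n; rewrite Hw; split; [tauto|].
intros Hn; split; [apply Hn; exact Hw0|exact Hn].
Qed.

Lemma omega_empty o : is_empty o -> omega o.
Proof.
intros Ho w [(o' & Ho' & H) _]; rewrite (empty_unique o o'); auto.
Qed.

Lemma omega_succ s n : is_succ s n -> omega n -> omega s.
Proof.
intros Hs Hn w Hw; destruct (proj2 Hw n (Hn w Hw)) as (s' & Hs' & H).
rewrite (succ_unique s s' n); auto.
Qed.

Lemma succ_exists n : exists s, is_succ s n.
Proof. exact (insert_exists n n). Qed.

(** The subset of ω cut out by [P] is an inductive set, hence contains every natural number. *)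
Lemma omega_ind (P : M -> Prop) : definable 1 (fun e => P (e 0)) ->
  (forall o, is_empty o -> P o) ->
  (forall s n, omega n -> P n -> is_succ s n -> P s) ->
  forall n, omega n -> P n.
Proof.
intros HP H0 HS n Hn; destruct omega_set as [w Hw].
destruct (separation P w HP) as [v Hv].
apply (Hv n), Hn; split.
- destruct empty_exists as [o Ho]; exists o; split; auto.
  apply Hv; split; [apply Hw, omega_empty|apply H0]; auto.
- intros m Hm; apply Hv in Hm as [Hm HPm]; apply Hw in Hm.
  destruct (succ_exists m) as [s Hs]; exists s; split; auto.
  apply Hv; split; [apply Hw; eapply omega_succ|eapply HS]; eauto.
Qed.

(** The main source of functions inside the model: replacement sends each x to the ordered pair of x
    and its unique value. The set [d] is the domain to which replacement is applied. *)
Lemma graph_exists (R : M -> M -> Prop) d (D C : M -> Prop) :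
  definable 2 (fun e => R (e 0) (e 1)) ->
  (forall x, x ∈ d <-> D x) ->
  (forall x, D x -> exists y, R x y) ->
  (forall x y, D x -> R x y -> C y) ->
  (forall x y y', D x -> R x y -> R x y' -> y = y') ->
  exists f, is_fun f D C /\ forall x y, app f x y <-> D x /\ R x y.
Proof.
intros HR Hd Htot HC Huniq.
destruct (replacement (fun x p => exists y, is_opair p x y /\ R x y) d)
  as [f Hf]; [definability| |].
- intros x p p' Hx (y & Hp & HRy) (y' & Hp' & HRy').
  apply Hd in Hx; assert (y = y') as <- by eauto.
  eapply opair_unique; eauto.
- assert (Happ : forall x y, app f x y <-> D x /\ R x y).
  { intros x y; split.
    - intros (p & Hp & Hpf); apply Hf in Hpf as (x' & Hx' & y' & Hp' & HRy').
      destruct (opair_inj p x y x' y' Hp Hp') as [-> ->].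
      split; [apply Hd|]; auto.
    - intros [Hx HRy]; destruct (opair_exists x y) as [p Hp].
      exists p; split; auto; apply Hf; exists x; split; [apply Hd|]; eauto. }
  exists f; split; [split|exact Happ].
  + intros p Hp; apply Hf in Hp as (x & Hx & y & Hp & HRy).
    apply Hd in Hx; exists x, y; eauto.
  + intros x Hx; destruct (Htot x Hx) as [y Hy]; exists y; split.
    * apply Happ; auto.
    * intros y' Hy'; apply Happ in Hy' as [_ Hy']; eauto.
Qed.

Lemma app_dom f (D C : M -> Prop) x y : is_fun f D C -> app f x y -> D x.
Proof.
intros [Hf _] (p & Hp & Hpf); destruct (Hf p Hpf) as (x' & y' & Hp' & Hx & _).
destruct (opair_inj p x y x' y' Hp Hp') as [-> _]; auto.
Qed.

Lemma app_cod f (D C : M -> Prop) x y : is_fun f D C -> app f x y -> C y.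
Proof.
intros [Hf _] (p & Hp & Hpf); destruct (Hf p Hpf) as (x' & y' & Hp' & _ & Hy).
destruct (opair_inj p x y x' y' Hp Hp') as [_ ->]; auto.
Qed.

Lemma app_total f (D C : M -> Prop) x : is_fun f D C -> D x ->
  exists y, app f x y.
Proof.
intros [_ Hf] Hx; destruct (Hf x Hx) as (y & Hy & _); eauto.
Qed.

Lemma app_unique f (D C : M -> Prop) x y y' : is_fun f D C ->
  app f x y -> app f x y' -> y = y'.
Proof.
intros Hf Hy Hy'.
destruct (proj2 Hf x (app_dom f D C x y Hf Hy)) as (y0 & _ & H).
rewrite <- (H y Hy); auto.
Qed.

Lemma fun_incl f g (D C : M -> Prop) : is_fun f D C ->
  (incl f g <-> forall x y, app f x y -> app g x y).
Proof.
intros Hf; split.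
- intros H x y (p & Hp & Hpf); exists p; auto.
- intros H p Hp; destruct (proj1 Hf p Hp) as (x & y & Hxy & _).
  destruct (H x y) as (q & Hq & Hqg); [exists p; auto|].
  rewrite (opair_unique p q x y); auto.
Qed.

Lemma fun_codomain f (D C C' : M -> Prop) : is_fun f D C ->
  (forall x y, app f x y -> C' y) -> is_fun f D C'.
Proof.
intros [Hf Hf'] H; split; auto.
intros p Hp; destruct (Hf p Hp) as (x & y & Hxy & Hx & _).
exists x, y; repeat split; auto; apply (H x y); exists p; auto.
Qed.

Lemma inverse_exists f (D C : M -> Prop) : bijection f D C ->
  exists g, is_inverse g f /\ is_fun g C D /\
    forall x y, app g y x <-> app f x y.
Proof.
intros [[Hf Hinj] Hsurj].
destruct (replacement
  (fun q p => exists x y, is_opair p y x /\ is_opair q x y) f) as [g Hg];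
  [definability| |].
- intros q p p' _ (x & y & Hp & Hq) (x' & y' & Hp' & Hq').
  destruct (opair_inj q x y x' y' Hq Hq') as [<- <-].
  eapply opair_unique; eauto.
- assert (Hinv : is_inverse g f).
  { intros p; rewrite Hg; split.
    - intros (q & Hq & x & y & Hp & Hxy); exists x, y, q; auto.
    - intros (x & y & q & Hp & Hxy & Hq); exists q; eauto. }
  assert (Happ : forall x y, app g y x <-> app f x y).
  { intros x y; split.
    - intros (p & Hp & Hpg); apply Hinv in Hpg as (x' & y' & q & Hp' & Hq & H).
      destruct (opair_inj p y x y' x' Hp Hp') as [-> ->]; exists q; auto.
    - intros (q & Hq & Hqf); destruct (opair_exists y x) as [p Hp].
      exists p; split; auto; apply Hinv; exists x, y, q; auto. }
  exists g; split; [exact Hinv|split; [split|exact Happ]].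
  + intros p Hp; apply Hinv in Hp as (x & y & q & Hp & Hq & Hqf).
    assert (H : app f x y) by (exists q; auto).
    exists y, x; split; [exact Hp|split]; [eapply app_cod|eapply app_dom]; eauto.
  + intros y Hy; destruct (Hsurj y Hy) as [x Hx]; exists x; split.
    * apply Happ; auto.
    * intros x' Hx'; apply Happ in Hx'; eapply Hinj; eauto.
Qed.

(** The preimage of V under the inverse is the image of V under [f], so continuity of the inverse is
    openness of [f]. *)
Lemma homeomorphism_intro (T1 T2 : @space M) f :
  bijection f (pts T1) (pts T2) -> continuous T1 T2 f ->
  (forall V, opn T1 V -> exists W, opn T2 W /\
    forall y, y ∈ W <-> pts T2 y /\ exists x, app f x y /\ x ∈ V) ->
  homeomorphism T1 T2 f.
Proof.
intros Hb Hc Ho; split; [exact Hb|split; [exact Hc|]].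
destruct (inverse_exists f _ _ Hb) as (g & Hg & Hfun & Happ).
exists g; split; [exact Hg|split; [exact Hfun|]].
intros V HV; destruct (Ho V HV) as (W & HW & H); exists W; split; [exact HW|].
intros y; rewrite H; split; intros (Hy & x & Hx & HxV);
  (split; [exact Hy|exists x; rewrite Happ in *; auto]).
Qed.

Lemma powerset_exists x : exists q, forall t, t ∈ q <-> power x t.
Proof. exact (zf_powerset M x). Qed.

(** * Finite sets *)

Lemma finite_empty x : is_empty x -> finite x.
Proof.
intros Hx.
destruct (graph_exists (fun a b => a = b) x (elts x) (elts x)) as (f & Hf & H);
  try (intros a; intros; exfalso; apply (Hx a); assumption).
- definability.
- reflexivity.
- exists x, f; split; [apply omega_empty, Hx|]; split; [split; [exact Hf|]|].
  + intros a a' b Ha; apply H in Ha as [Ha _]; destruct (Hx a Ha).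
  + intros b Hb; destruct (Hx b Hb).
Qed.

(** A new point a is sent to n, extending a bijection onto n to one onto n + 1; injectivity rests on
    n ∉ n. *)
Lemma finite_insert x a x' : finite x -> (forall t, t ∈ x' <-> t ∈ x \/ t = a) ->
  finite x'.
Proof.
intros Hfin Hx'; destruct (classic (a ∈ x)) as [Hax|Hax].
{ replace x' with x; [exact Hfin|].
  apply zf_extensionality; intros t; rewrite Hx'; split; [tauto|].
  intros [H| ->]; auto. }
destruct Hfin as (n & f & Hn & [[Hf Hinj] Hsurj]).
destruct (succ_exists n) as [s Hs].
assert (Ha : forall y, ~ app f a y)
  by (intros y Hy; apply Hax; exact (app_dom f _ _ a y Hf Hy)).
destruct (graph_exists (fun t y => app f t y \/ (t = a /\ y = n)) x'
  (elts x') (elts s)) as (g & Hg & Happ).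
- definability.
- reflexivity.
- intros t Ht; apply Hx' in Ht as [Ht| ->]; [|eauto].
  destruct (app_total f _ _ t Hf Ht) as [y Hy]; eauto.
- intros t y _ [H|[_ ->]]; apply Hs; auto.
  left; exact (app_cod f _ _ t y Hf H).
- intros t y y' _ [H|[-> ->]] [H'|[Et ->]]; subst; auto.
  + eapply app_unique; eauto.
  + destruct (Ha y H).
  + destruct (Ha y' H').
- assert (Hnn : forall t, ~ app f t n)
    by (intros t Ht; exact (not_mem_self n (app_cod f _ _ t n Hf Ht))).
  exists s, g; split; [eapply omega_succ; eauto|split; [split; [exact Hg|]|]].
  + intros t t' y Ht Ht'; apply Happ in Ht as [_ Ht]; apply Happ in Ht' as [_ Ht'].
    destruct Ht as [H|[-> ->]], Ht' as [H'|[-> ?]]; subst; auto.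
    * eapply Hinj; eauto.
    * destruct (Hnn t H).
    * destruct (Hnn t' H').
  + intros y Hy; apply Hs in Hy as [Hy| ->].
    * destruct (Hsurj y Hy) as [t Ht]; exists t; apply Happ; split; auto.
      apply Hx'; left; exact (app_dom f _ _ t y Hf Ht).
    * exists a; apply Happ; split; auto; apply Hx'; auto.
Qed.

(** Induction on the cardinality n, for all sets and bijections at once: removing the preimage of
    the top element n of n + 1 leaves a set in bijection with n. *)
Lemma finite_ind (P : M -> Prop) : definable 1 (fun e => P (e 0)) ->
  (forall x, is_empty x -> P x) ->
  (forall x a x', P x -> a ∉ x -> (forall t, t ∈ x' <-> t ∈ x \/ t = a) ->
     P x') ->
  forall x, finite x -> P x.
Proof.
intros HP H0 HS.
assert (H : forall n, omega n ->
  forall x f, bijection f (elts x) (elts n) -> P x).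
{ apply (omega_ind (fun n => forall x f, bijection f (elts x) (elts n) -> P x)).
  - definability.
  - intros o Ho x f [[Hf _] _]; apply H0; intros t Ht.
    destruct (app_total f _ _ t Hf Ht) as [y Hy].
    exact (Ho y (app_cod f _ _ t y Hf Hy)).
  - intros s n _ IH Hs x f [[Hf Hinj] Hsurj].
    destruct (Hsurj n) as [a Ha]; [apply Hs; auto|].
    destruct (separation (fun t => t <> a) x) as [y Hy]; [definability|].
    destruct (graph_exists (fun t b => app f t b) y (elts y) (elts n))
      as (g & Hg & Happ).
    + definability.
    + reflexivity.
    + intros t Ht; apply Hy in Ht as [Ht _]; exact (app_total f _ _ t Hf Ht).
    + intros t b Ht Hb; assert (Hbs := app_cod f _ _ t b Hf Hb).
      apply Hs in Hbs as [Hbs| ->]; [exact Hbs|].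
      apply Hy in Ht as [_ Ht]; destruct Ht; eapply Hinj; eauto.
    + intros t b b' _; exact (app_unique f _ _ t b b' Hf).
    + apply (HS y a x).
      * apply (IH y g); split; [split; [exact Hg|]|].
        -- intros t t' b Ht Ht'; apply Happ in Ht; apply Happ in Ht'.
           eapply Hinj; [apply Ht|apply Ht'].
        -- intros b Hb; destruct (Hsurj b) as [t Ht]; [apply Hs; auto|].
           exists t; apply Happ; split; auto; apply Hy.
           split; [exact (app_dom f _ _ t b Hf Ht)|intros ->].
           rewrite (app_unique f _ _ a n b Hf Ha Ht) in Hb.
           exact (not_mem_self b Hb).
      * rewrite Hy; tauto.
      * intros t; rewrite Hy; split.
        -- intros Ht; destruct (classic (t = a)); auto.
        -- intros [[Ht _]| ->]; [exact Ht|exact (app_dom f _ _ a n Hf Ha)]. }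
intros x (n & f & Hn & Hf); eauto.
Qed.

(* If f is an injection of omega into y ∪ {a}, then m ↦ f(m + 1), with the
   value a replaced by f(0), is an injection into y. *)
Lemma finite_no_omega_injection y : finite y ->
  ~ exists f, injection f omega (elts y).
Proof.
revert y; apply finite_ind.
- definability.
- intros y Hy (f & Hf & _); destruct empty_exists as [o Ho].
  destruct (app_total f _ _ o Hf (omega_empty o Ho)) as [b Hb].
  exact (Hy b (app_cod f _ _ o b Hf Hb)).
- intros y a y' IH _ Hy' (f & Hf & Hinj); apply IH.
  destruct omega_set as [w Hw].
  destruct empty_exists as [o Ho].
  assert (Hoo := omega_empty o Ho).
  assert (Hsucc : forall s m, is_succ s m -> s <> o).
  { intros s m Hs ->; apply (Ho m), Hs; auto. }
  destruct (graph_exists (fun m b => exists s c, is_succ s m /\ app f s c /\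
    ((c <> a /\ b = c) \/ (c = a /\ app f o b))) w omega (elts y))
    as (g & Hg & Happ).
  + definability.
  + exact Hw.
  + intros m Hm; destruct (succ_exists m) as [s Hs].
    destruct (app_total f _ _ s Hf (omega_succ s m Hs Hm)) as [c Hc].
    destruct (classic (c = a)) as [Ec|Ec].
    * destruct (app_total f _ _ o Hf Hoo) as [b Hb]; exists b, s, c; auto.
    * exists c, s, c; auto.
  + intros m b Hm (s & c & Hs & Hc & [[Hca ->]|[-> Hb]]).
    * assert (H := app_cod f _ _ s c Hf Hc); apply Hy' in H as [H|H]; auto.
      contradiction.
    (* The value a is already taken at the successor s, and s is not 0; hence f(0) lies in y. *)
    * assert (H := app_cod f _ _ o b Hf Hb); apply Hy' in H as [H| ->]; auto.
      destruct (Hsucc s m Hs); eapply Hinj; eauto.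
  + intros m b b' _ (s & c & Hs & Hc & H) (s' & c' & Hs' & Hc' & H').
    rewrite (succ_unique s s' m Hs Hs') in Hc.
    assert (c = c') as <- by (eapply app_unique; eauto).
    destruct H as [[Hca ->]|[-> Hb]], H' as [[Hca' ->]|[E Hb']]; try congruence.
    eapply app_unique; eauto.
  + exists g; split; [exact Hg|].
    intros m m' b Hm Hm'.
    apply Happ in Hm as (_ & s & c & Hs & Hc & H).
    apply Happ in Hm' as (_ & s' & c' & Hs' & Hc' & H').
    assert (Es : s = s').
    (* In the mixed cases one successor would have the value f(0), so it would be 0. *)
    { destruct H as [[Hca ->]|[-> Hb]], H' as [[Hca' E]|[E Hb']]; subst.
      - eapply Hinj; eauto.
      - destruct (Hsucc s m Hs); eapply Hinj; eauto.
      - destruct (Hsucc s' m' Hs'); eapply Hinj; eauto.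
      - eapply Hinj; eauto. }
    subst s'; eapply succ_inj; eauto.
Qed.

(** By induction, since P(y ∪ {a}) consists of P(y) together with the sets s ∪ {a} for s in P(y). *)
Lemma finite_powerset y : finite y ->
  forall q, (forall t, t ∈ q <-> power y t) -> finite q.
Proof.
revert y; apply (finite_ind (fun y =>
  forall q, (forall t, t ∈ q <-> power y t) -> finite q)).
- definability.
- intros y Hy q Hq; destruct empty_exists as [o Ho].
  apply (finite_insert o y); [apply finite_empty, Ho|].
  intros t; rewrite Hq; split.
  + intros Ht; right; apply zf_extensionality; intros r; split; [apply Ht|].
    intros Hr; destruct (Hy r Hr).
  + intros [H| ->]; [destruct (Ho t H)|intros r Hr; exact Hr].
- intros y a y' IH _ Hy' q' Hq'.
  destruct (powerset_exists y) as [q Hq].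
  (* An inner induction on k adjoins to q = P(y) the sets s ∪ {a} with s in k; it is used for k =
     q. *)
  assert (H : forall k, finite k -> forall k', (forall t, t ∈ k' <-> t ∈ q \/
    exists s, s ∈ k /\ forall r, r ∈ t <-> r ∈ s \/ r = a) -> finite k').
  { apply (finite_ind (fun k => forall k', (forall t, t ∈ k' <-> t ∈ q \/
      exists s, s ∈ k /\ forall r, r ∈ t <-> r ∈ s \/ r = a) -> finite k')).
    - definability.
    - intros k Hk k' Hk'; replace k' with q; [apply (IH q Hq)|].
      apply zf_extensionality; intros t; rewrite Hk'; split; [tauto|].
      intros [H|(s & Hs & _)]; [exact H|destruct (Hk s Hs)].
    - intros k b k1 IHk _ Hk1 k' Hk'.
      destruct (insert_exists b a) as [b' Hb'].
      (* [k0] is the family belonging to [k]; the new member b of [k1] contributes just b' = b ∪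
         {a}. *)
      destruct (separation (fun t => t ∈ q \/
        exists s, s ∈ k /\ forall r, r ∈ t <-> r ∈ s \/ r = a) k')
        as [k0 Hk0]; [definability|].
      apply (finite_insert k0 b').
      + apply IHk; intros t; rewrite Hk0, Hk'; split; [tauto|].
        intros [H|(s & Hs & H)]; (split; [|eauto]); [tauto|].
        right; exists s; rewrite Hk1; auto.
      + intros t; rewrite Hk0, Hk'; split.
        * intros [H|(s & Hs & H)]; [tauto|].
          apply Hk1 in Hs as [Hs| ->].
          -- left; split; right; exists s; rewrite ?Hk1; auto.
          -- right; apply zf_extensionality; intros r.
             rewrite H, Hb'; tauto.
        * intros [[H _]| ->]; [exact H|].
          right; exists b; rewrite Hk1; auto. }
  apply (H q (IH q Hq)); intros t; rewrite Hq', Hq; split.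
  + intros Ht; destruct (classic (a ∈ t)) as [Hat|Hat].
    * right; destruct (separation (fun r => r <> a) t) as [s Hs];
        [definability|].
      exists s; rewrite Hq; split.
      -- intros r Hr; apply Hs in Hr as [Hr Hra]; apply Ht in Hr.
         apply Hy' in Hr; tauto.
      -- intros r; rewrite Hs; destruct (classic (r = a)) as [->|]; tauto.
    * left; intros r Hr; assert (Hr' := Ht r Hr); apply Hy' in Hr' as [H'| ->];
        [exact H'|contradiction].
  + intros [Ht|(s & Hs & Ht)] r Hr; apply Hy'; [left; apply Ht, Hr|].
    apply Hq in Hs; apply Ht in Hr as [Hr| ->]; auto.
Qed.

(** * Indicator functions and the two topologies *)

Lemma indicator_exists X x : exists f, is_indicator X x f.
Proof.
destruct (graph_exists (fun t i => (t ∈ x /\ is_one i) \/ (t ∉ x /\ is_empty i))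
  X (elts X) two) as (f & Hf & Happ).
- definability.
- reflexivity.
- intros t _; destruct one_exists as [i Hi], empty_exists as [o Ho].
  destruct (classic (t ∈ x)); [exists i|exists o]; auto.
- intros t i _ [[_ H]|[_ H]]; [right|left]; exact H.
- intros t i i' _ [[H Hi]|[H Hi]] [[H' Hi']|[H' Hi']]; try contradiction.
  + apply one_unique; auto.
  + apply empty_unique; auto.
- exists f; split; [exact Hf|]; intros t Ht; split; intros H.
  + destruct one_exists as [i Hi]; exists i; split; [|apply Happ]; auto.
  + destruct empty_exists as [o Ho]; exists o; split; [|apply Happ]; auto.
Qed.

Lemma indicator_app X x f : is_indicator X x f -> forall t i, app f t i <->
  t ∈ X /\ ((t ∈ x /\ is_one i) \/ (t ∉ x /\ is_empty i)).
Proof.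
intros [Hf H] t i; split.
- intros Hi; assert (Ht := app_dom f _ _ t i Hf Hi); split; [exact Ht|].
  destruct (H t Ht) as [H1 H0], (classic (t ∈ x)) as [Hx|Hx].
  + destruct (H1 Hx) as (j & Hj & Hj').
    rewrite (app_unique f _ _ t i j Hf Hi Hj'); auto.
  + destruct (H0 Hx) as (j & Hj & Hj').
    rewrite (app_unique f _ _ t i j Hf Hi Hj'); auto.
- intros (Ht & [[Hx Hi]|[Hx Hi]]); destruct (H t Ht) as [H1 H0].
  + destruct (H1 Hx) as (j & Hj & Hj'); rewrite (one_unique i j); auto.
  + destruct (H0 Hx) as (j & Hj & Hj'); rewrite (empty_unique i j); auto.
Qed.

(** The dictionary between cylinders and subsets: with p the indicator of x ∩ z on z, the cylinder
    [p] becomes {y : y ∩ z = x ∩ z}. It rests on 0 ≠ 1. *)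
Lemma indicator_incl z X x y p f : is_indicator z x p -> is_indicator X y f ->
  incl z X -> (incl p f <-> agree z x y).
Proof.
intros Hp Hf HzX; rewrite (fun_incl p f _ _ (proj1 Hp)).
assert (Hp' := indicator_app z x p Hp); assert (Hf' := indicator_app X y f Hf).
destruct one_exists as [i Hi], empty_exists as [o Ho].
assert (Hio := one_not_empty).
split.
- intros H t Ht; split; intros Ht'.
  + assert (H1 : app f t i) by (apply H, Hp'; auto).
    apply Hf' in H1 as (_ & [[H1 _]|[_ H1]]); [exact H1|].
    destruct (Hio i Hi H1).
  + apply NNPP; intros Hx.
    assert (H1 : app f t o) by (apply H, Hp'; auto).
    apply Hf' in H1 as (_ & [[_ H1]|[H1 _]]); [|contradiction].
    destruct (Hio o H1 Ho).
- intros H t j Hj; apply Hp' in Hj as (Ht & Hj); apply Hf'.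
  split; [auto|]; rewrite <- (H t Ht); exact Hj.
Qed.

Lemma indicator_unique X x f g : is_indicator X x f -> is_indicator X x g ->
  f = g.
Proof.
intros Hf Hg; apply zf_extensionality.
assert (H := indicator_incl X X x x); unfold agree, incl in H.
intros t; split; [apply (H f g)|apply (H g f)]; auto; tauto.
Qed.

Lemma indicator_inj X x y f : incl x X -> incl y X ->
  is_indicator X x f -> is_indicator X y f -> x = y.
Proof.
intros Hx Hy Hf Hf'.
assert (H : agree X x y)
  by (apply (indicator_incl X X x y f f Hf Hf'); intros t; auto).
apply zf_extensionality; intros t; split; intros Ht; apply (H t); auto.
Qed.

Lemma cantor_indicator X f : cantor X f ->
  exists x, incl x X /\ is_indicator X x f.
Proof.
intros Hf.
destruct (separation (fun t => exists i, is_one i /\ app f t i) X) as [x Hx];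
  [definability|].
exists x; split; [intros t Ht; apply Hx in Ht; tauto|].
split; [exact Hf|]; intros t Ht; split; intros H.
- apply Hx in H; tauto.
- destruct (app_total f _ _ t Hf Ht) as [i Hi]; exists i; split; [|exact Hi].
  destruct (app_cod f _ _ t i Hf Hi) as [Hi'|Hi']; [exact Hi'|].
  destruct H; apply Hx; eauto.
Qed.

Lemma cantor_part_indicator X (B : M -> Prop) f : (forall x, B x -> incl x X) ->
  (cantor_part X B f <-> exists x, B x /\ is_indicator X x f).
Proof.
intros HB; split.
- intros (Hf & x & Hx & H); exists x; split; [exact Hx|].
  destruct (cantor_indicator X f Hf) as (y & Hy & Hyf).
  replace x with y; [exact Hyf|].
  apply zf_extensionality; intros t; rewrite H; split.
  + intros Ht; apply (proj2 Hyf t (Hy t Ht)); exact Ht.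
  + intros (i & Hi & Hti); apply (indicator_app X y f Hyf) in Hti
      as (_ & [[Ht _]|[_ Hi']]); [exact Ht|destruct (one_not_empty i Hi Hi')].
- intros (x & Hx & Hf); split; [apply Hf|]; exists x; split; [exact Hx|].
  intros t; split.
  + intros Ht; apply (proj2 Hf t (HB x Hx t Ht)); exact Ht.
  + intros (i & Hi & Hti); apply (indicator_app X x f Hf) in Hti
      as (_ & [[Ht _]|[_ Hi']]); [exact Ht|destruct (one_not_empty i Hi Hi')].
Qed.

(** Every function into 2 is an indicator, so 2^X is the replacement image of P(X) under x ↦ χ_x. *)
Lemma cantor_set X : exists s, forall f, f ∈ s <-> cantor X f.
Proof.
destruct (powerset_exists X) as [q Hq].
destruct (replacement (is_indicator X) q) as [s Hs]; [definability| |].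
- intros x f f' _; apply indicator_unique.
- exists s; intros f; rewrite Hs; split.
  + intros (x & _ & Hf); apply Hf.
  + intros Hf; destruct (cantor_indicator X f Hf) as (x & Hx & Hxf).
    exists x; rewrite Hq; auto.
Qed.

(** * Comparison of the two topologies *)

Section Spaces.
Variables X Z : M.
Hypothesis hid : ideal X Z.

(** Translates τ_2[Z] into subsets of X, eliminating the partial functions p. *)
Lemma opn_cantor V : opn (cantor_space X Z) V <->
  (forall f, f ∈ V -> cantor X f) /\
  (forall x f, is_indicator X x f -> f ∈ V ->
     exists z, z ∈ Z /\ ~ is_empty z /\
       forall y g, is_indicator X y g -> agree z x y -> g ∈ V).
Proof.
assert (HZ := proj1 hid).
split; intros [Hsub H]; (split; [exact Hsub|]).
- intros x f Hxf Hf; destruct (H f Hf) as (z & Hz & Hne & p & Hp & [_ Hpf] & HV).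
  exists z; split; [exact Hz|split; [exact Hne|]].
  intros y g Hyg Hxy; apply HV; split; [apply Hyg|].
  (* The given p is the indicator on z of some x', and p ⊆ f = χ_x makes x' and x agree on z. *)
  destruct (cantor_indicator z p Hp) as (x' & _ & Hx').
  assert (Hxx' := proj1 (indicator_incl z X x' x p f Hx' Hxf (HZ z Hz)) Hpf).
  apply (indicator_incl z X x' y p g Hx' Hyg (HZ z Hz)).
  intros t Ht; rewrite (Hxx' t Ht); apply Hxy, Ht.
- intros f Hf; destruct (cantor_indicator X f (Hsub f Hf)) as (x & _ & Hxf).
  destruct (H x f Hxf Hf) as (z & Hz & Hne & HV).
  exists z; split; [exact Hz|split; [exact Hne|]].
  destruct (indicator_exists z x) as [p Hp]; exists p.
  split; [apply Hp|split; [split; [apply Hxf|]|]].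
  + apply (indicator_incl z X x x p f Hp Hxf (HZ z Hz)); intros t _; tauto.
  + intros g [Hg Hpg]; destruct (cantor_indicator X g Hg) as (y & _ & Hyg).
    apply (HV y g Hyg), (indicator_incl z X x y p g Hp Hyg (HZ z Hz)), Hpg.
Qed.

(** The family is carried twice: spaces take the predicate [B], whereas separation needs the
    condition of membership in the set [b]. *)
Variables (b : M) (B : M -> Prop).
Hypothesis hb : forall x, x ∈ b <-> B x.
Hypothesis hB : forall x, B x -> incl x X.

Lemma indicator_preimage_open V : opn (cantor_space X Z) V ->
  exists W, opn (S_space X Z B) W /\
    forall x, x ∈ W <-> B x /\ exists f, is_indicator X x f /\ f ∈ V.
Proof.
intros HV; apply opn_cantor in HV as [Hsub HV].
destruct (separation (fun x => exists f, is_indicator X x f /\ f ∈ V) b)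
  as [W HW]; [definability|].
assert (HW' : forall x, x ∈ W <-> B x /\ exists f, is_indicator X x f /\ f ∈ V)
  by (intros x; rewrite HW, hb; reflexivity).
exists W; split; [|exact HW'].
split; [intros x Hx; apply HW' in Hx; tauto|].
intros x Hx; apply HW' in Hx as (Hx & f & Hxf & Hf).
destruct (HV x f Hxf Hf) as (z & Hz & _ & H).
(* With z' = z \ x, every y with x ⊆ y ⊆ X \ z' agrees with x on z. *)
destruct (separation (fun t => t ∉ x) z) as [z' Hz']; [definability|].
exists z'; split; [|split].
- destruct hid as (_ & _ & Hdown & _); apply (Hdown z z' Hz).
  intros t Ht; apply Hz' in Ht; tauto.
- intros t Ht Ht'; apply Hz' in Ht'; tauto.
- intros y Hy Hxy Hyz; apply HW'; split; [exact Hy|].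
  destruct (indicator_exists X y) as [g Hg]; exists g; split; [exact Hg|].
  apply (H y g Hg); intros t Ht; split; [apply Hxy|].
  intros Hty; apply NNPP; intros Htx; apply (proj2 (Hyz t Hty)), Hz'; auto.
Qed.

Hypothesis hXZ : exists z, z ∈ Z /\ ~ is_empty z.
Hypothesis hBZ : forall x, B x -> x ∈ Z.

(* U is the largest open set whose trace on the image of B lies in that of V.  A basic
   neighbourhood of x in V only excludes points outside x; it contains a basic
   neighbourhood of χ_x because x itself belongs to Z. *)
Lemma indicator_image_open V : opn (S_space X Z B) V ->
  exists U, opn (cantor_space X Z) U /\
    forall x f, B x -> is_indicator X x f -> (f ∈ U <-> x ∈ V).
Proof.
intros [Hsub HV]; destruct (cantor_set X) as [s Hs].
destruct (separation (fun f => exists x z, is_indicator X x f /\ z ∈ Z /\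
  ~ is_empty z /\ forall y, y ∈ b -> agree z x y -> y ∈ V) s) as [U HU];
  [definability|].
exists U; split.
- apply opn_cantor; split.
  + intros f Hf; apply HU in Hf as [Hf _]; apply Hs, Hf.
  + intros x f Hxf Hf; apply HU in Hf as (_ & x' & z & Hx'f & Hz & Hne & H).
    exists z; split; [exact Hz|split; [exact Hne|]].
    (* The same z works at y, because agreement on z is transitive. *)
    intros y g Hyg Hxy; apply HU; split; [apply Hs, Hyg|].
    exists y, z; split; [exact Hyg|split; [exact Hz|split; [exact Hne|]]].
    intros y' Hy' Hyy'; apply (H y' Hy'); intros t Ht.
    assert (Hxx' : agree X x' x).
    { apply (indicator_incl X X x' x f f Hx'f Hxf); intros r; auto. }
    rewrite (Hxx' t (proj1 hid z Hz t Ht)), (Hxy t Ht); apply Hyy', Ht.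
- intros x f Hx Hxf; rewrite HU; split.
  + intros (_ & x' & z & Hx'f & Hz & _ & H).
    apply H; [apply hb, Hx|]; intros t Ht.
    assert (Hxx' : agree X x' x).
    { apply (indicator_incl X X x' x f f Hx'f Hxf); intros r; auto. }
    apply Hxx', (proj1 hid z Hz t Ht).
  + intros HxV; split; [apply Hs, Hxf|].
    destruct (HV x HxV) as (z & Hz & Hdisj & H), hXZ as (z0 & Hz0 & Hne).
    (* The index set is x ∪ z ∪ z0; the summand z0 ensures that it is nonempty, as τ_2[Z]
       demands. *)
    destruct (union_exists x z) as [u Hu], (union_exists u z0) as [w Hw].
    exists x, w; split; [exact Hxf|split; [|split]].
    * destruct hid as (_ & _ & _ & Hunion).
      apply (Hunion u z0); auto; apply (Hunion x z); auto.
    * apply nonempty_elt in Hne as [t Ht]; intros H'; apply (H' t), Hw; auto.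
    * intros y Hy Hxy; apply hb in Hy; apply H; [exact Hy| |].
      -- intros t Ht; apply Hxy; [rewrite Hw, Hu|]; auto.
      -- intros t Ht; split; [exact (hB y Hy t Ht)|]; intros Htz.
         apply (Hdisj t); [apply Hxy; [rewrite Hw, Hu|]|]; auto.
Qed.

Lemma indicator_map_homeomorphism h :
  is_fun h B (cantor_part X B) ->
  (forall x f, app h x f <-> B x /\ is_indicator X x f) ->
  homeomorphism (S_space X Z B) (subspace (cantor_space X Z) (cantor_part X B))
    h.
Proof.
intros Hh Happ; assert (Hpart := cantor_part_indicator X B).
apply homeomorphism_intro.
- split; [split; [exact Hh|]|].
  + intros x y f Hx Hy; apply Happ in Hx as [Hx Hxf]; apply Happ in Hy as [Hy Hyf].
    eapply indicator_inj; eauto.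
  + intros f Hf; apply (Hpart f hB) in Hf as (x & Hx); exists x; apply Happ, Hx.
- split; [exact Hh|]; intros V (U & HU & HV).
  destruct (indicator_preimage_open U HU) as (W & HW & H).
  exists W; split; [exact HW|]; intros x; rewrite H; split.
  + intros (Hx & f & Hxf & Hf); split; [exact Hx|].
    exists f; split; [apply Happ; auto|apply HV; split; [exact Hf|]].
    apply (Hpart f hB); eauto.
  + intros (Hx & f & Hxf & Hf); split; [exact Hx|]; exists f.
    split; [apply Happ, Hxf|apply HV, Hf].
- intros V HV; destruct (indicator_image_open V HV) as (U & HU & H).
  (* Definability is visible for [elts b], not for the abstract predicate [B]. *)
  destruct (separation (cantor_part X (elts b)) U) as [W HW]; [definability|].
  assert (Hb : forall f, cantor_part X (elts b) f <-> cantor_part X B f).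
  { intros f; split; intros (Hf & x & Hx & H'); (split; [exact Hf|]);
      exists x; (split; [apply hb, Hx|exact H']). }
  exists W; split.
  + exists U; split; [exact HU|]; intros f; rewrite HW, Hb; reflexivity.
  + intros f; rewrite HW, Hb; split.
    * intros [HfU Hf]; split; [exact Hf|].
      apply (Hpart f hB) in Hf as (x & Hx & Hxf).
      exists x; rewrite Happ; split; [auto|]; apply (H x f Hx Hxf), HfU.
    * intros (Hf & x & Hxf & HxV); split; [|exact Hf].
      apply Happ in Hxf as [Hx Hxf]; apply (H x f Hx Hxf), HxV.
Qed.

End Spaces.

Lemma restriction_fun h g (D B C C' : M -> Prop) : is_fun h D C ->
  is_restriction g h B ->
  (forall x, B x -> D x) -> (forall x y, B x -> app h x y -> C' y) ->
  is_fun g B C' /\ forall x y, app g x y <-> B x /\ app h x y.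
Proof.
intros Hh Hg HBD HC.
assert (Happ : forall x y, app g x y <-> B x /\ app h x y).
{ intros x y; split.
  - intros (p & Hp & Hpg); apply Hg in Hpg as (Hph & x' & y' & Hp' & Hx').
    destruct (opair_inj p x y x' y' Hp Hp') as [-> _].
    split; [exact Hx'|exists p; auto].
  - intros (Hx & p & Hp & Hph); exists p; split; [exact Hp|].
    apply Hg; split; [exact Hph|eauto]. }
split; [split|exact Happ].
- intros p Hp; destruct (proj1 (Hg p) Hp) as (_ & x & y & Hxy & Hx).
  exists x, y; repeat split; auto.
  apply (HC x y Hx), Happ; exists p; auto.
- intros x Hx; destruct (app_total h D C x Hh (HBD x Hx)) as [y Hy].
  exists y; split; [apply Happ; auto|].
  intros y' Hy'; apply Happ in Hy' as [_ Hy']; eapply app_unique; eauto.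
Qed.

(* The point X is isolated in S_P(X, Z), whereas an isolated point of 2^X[Z]
   yields a member of Z outside of which no coordinate is left to change. *)
Lemma homeomorphic_mem X Z : ideal X Z ->
  homeomorphic (S_space X Z (power X)) (cantor_space X Z) -> X ∈ Z.
Proof.
intros hid (h & [[Hh _] _] & _ & g & Hg & Hgfun & Hcont).
(* V = {X}; its preimage W under the inverse of [h] is the singleton of h(X). *)
destruct (zf_pairing M X X) as [V HV].
assert (Hopen : opn (S_space X Z (power X)) V).
{ split.
  - intros x Hx; apply HV in Hx; intros t; destruct Hx as [->| ->]; auto.
  - intros x Hx; assert (x = X) as -> by (apply HV in Hx; tauto).
    (* The empty member of Z already isolates X, since no subset of X properly contains X. *)
    destruct empty_exists as [o Ho]; exists o; split; [apply hid, Ho|].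
    split; [intros t _; apply Ho|]; intros y Hy HXy _; apply HV; left.
    apply zf_extensionality; intros t; split; auto. }
destruct (Hcont V Hopen) as (W & HW & HWV).
assert (HXX : power X X) by (intros t; auto).
destruct (app_total h _ _ X Hh HXX) as [f Hf].
assert (Hinv : forall f', app g f' X <-> app h X f').
{ intros f'; split; intros (p & Hp & Hpf).
  - apply Hg in Hpf as (x & y & q & Hp' & Hq & Hqh).
    destruct (opair_inj p f' X y x Hp Hp') as [-> ->]; exists q; auto.
  - destruct (opair_exists f' X) as [q Hq]; exists q; split; [exact Hq|].
    apply Hg; exists X, f', p; auto. }
assert (HWf : forall f', f' ∈ W <-> f' = f).
{ intros f'; rewrite HWV; split.
  - intros (_ & y & Hy & HyV); assert (y = X) as -> by (apply HV in HyV; tauto).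
    apply Hinv in Hy; exact (app_unique h _ _ X f' f Hh Hy Hf).
  - intros ->; split; [exact (app_cod h _ _ X f Hh Hf)|].
    exists X; rewrite Hinv, HV; auto. }
apply (opn_cantor X Z hid) in HW as [_ HW].
destruct (cantor_indicator X f (app_cod h _ _ X f Hh Hf)) as (x & Hx & Hxf).
destruct (HW x f Hxf) as (z & Hz & _ & H); [apply HWf; reflexivity|].
assert (HXz : incl X z).
{ intros r Hr; apply NNPP; intros Hrz.
  (* y is x with the coordinate r outside z flipped. It agrees with x on z, so χ_y would lie in W
     and equal χ_x. *)
  destruct (separation (fun t => (t ∈ x /\ t <> r) \/ (t = r /\ r ∉ x)) X)
    as [y Hy]; [definability|].
  destruct (indicator_exists X y) as [f' Hf'].
  assert (E : f' = f).
  { apply HWf, (H y f' Hf'); intros t Ht; rewrite Hy.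
    assert (t <> r) by (intros ->; contradiction).
    assert (Htx := proj1 hid z Hz t Ht); tauto. }
  rewrite E in Hf'.
  assert (Exy : x = y).
  { apply (indicator_inj X x y f); auto; intros t Ht; apply Hy in Ht; tauto. }
  assert (Hr' := Hy r); rewrite <- Exy in Hr'; tauto. }
destruct hid as (_ & _ & Hdown & _); apply (Hdown z X Hz HXz).
Qed.

(** * Closedness of the set of finite indicators *)

(** The criterion shared by both closedness clauses: all y with y ∩ c = x ∩ c = c contain c, so the
    cylinder over c around χ_x contains no indicator of a finite set. *)
Lemma finite_part_closed X Z : ideal X Z ->
  (forall x, incl x X -> infinite x -> exists c, c ∈ Z /\ incl c x /\
     forall y, incl c y -> infinite y) ->
  closed_in (cantor_space X Z) (cantor_part X (finite_subsets X)).
Proof.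
intros hid H; split; [intros f [Hf _]; exact Hf|].
destruct (cantor_set X) as [s Hs].
destruct (separation (fun f => ~ cantor_part X (finite_subsets X) f) s)
  as [V HV]; [definability|].
assert (HV' : forall f, f ∈ V <->
  cantor X f /\ ~ cantor_part X (finite_subsets X) f)
  by (intros f; rewrite HV, Hs; reflexivity).
assert (Hsub : forall x, finite_subsets X x -> incl x X) by (intros x Hx; apply Hx).
exists V; split; [|exact HV'].
apply (opn_cantor X Z hid); split; [intros f Hf; apply HV' in Hf; tauto|].
intros x0 f Hx0f Hf; apply HV' in Hf as [Hf Hinf].
destruct (cantor_indicator X f Hf) as (x & Hx & Hxf).
destruct (H x Hx) as (c & Hc & Hcx & Hcy).
{ intros Hfin; apply Hinf, (cantor_part_indicator X _ f Hsub).
  exists x; split; [split; auto|exact Hxf]. }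
exists c; split; [exact Hc|split].
(* The index set must be nonempty: an empty c would be a finite superset of itself. *)
{ intros Hce; apply (Hcy c (fun t Ht => Ht)), finite_empty, Hce. }
intros y g Hyg Hx0y; apply HV'; split; [apply Hyg|].
intros Hg; apply (cantor_part_indicator X _ g Hsub) in Hg as (y' & [Hy' Hfin] & Hy'g).
apply (Hcy y'); [|exact Hfin].
(* [is_indicator] does not constrain a set outside X, so two sets with the same indicator are
   compared on X only. *)
assert (Hagree : forall u v k, is_indicator X u k -> is_indicator X v k ->
  agree X u v).
{ intros u v k Hu Hv; apply (indicator_incl X X u v k k Hu Hv); intros r; auto. }
intros t Ht; assert (HtX := Hx t (Hcx t Ht)).
apply (Hagree y y' g Hyg Hy'g t HtX), (Hx0y t Ht).
apply (Hagree x x0 f Hxf Hx0f t HtX), Hcx, Ht.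
Qed.

(** c is the range of an injection of ω, counted by the inverse; a finite superset of c would
    receive this injection. *)
Lemma dedekind_infinite_countable_subset x :
  ~ dedekind_finite (elts x) -> exists c, countable c /\ incl c x /\
    forall y, incl c y -> infinite y.
Proof.
intros H; apply NNPP in H as (f & Hf & Hinj).
destruct (separation (fun t => exists n, app f n t) x) as [c Hc]; [definability|].
exists c; split; [|split].
- destruct (graph_exists (fun t n => app f n t) c (elts c) omega)
    as (g & Hg & Happ).
  + definability.
  + reflexivity.
  + intros t Ht; apply Hc in Ht; tauto.
  + intros t n _; exact (app_dom f _ _ n t Hf).
  + intros t n n' _; apply Hinj.
  + exists g; split; [exact Hg|]; intros t t' n Ht Ht'.
    apply Happ in Ht as [_ Ht]; apply Happ in Ht' as [_ Ht'].
    exact (app_unique f _ _ n t t' Hf Ht Ht').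
- intros t Ht; apply Hc in Ht; tauto.
- intros y Hcy Hfin; apply (finite_no_omega_injection y Hfin).
  exists f; split; [|exact Hinj]; apply (fun_codomain f _ _ _ Hf).
  intros n t Ht; apply Hcy, Hc; split; [exact (app_cod f _ _ n t Hf Ht)|eauto].
Qed.

(** c is the union of an injective sequence of finite sets. A finite y ⊇ c would have a finite power
    set containing the whole sequence. The sequence itself is returned so that closure of a σ-ideal
    can be applied to it. *)
Lemma quasi_dedekind_infinite_union x :
  ~ quasi_dedekind_finite x -> exists s c,
    is_fun s omega (finite_subsets x) /\
    (forall t, t ∈ c <-> exists n z, app s n z /\ t ∈ z) /\
    incl c x /\ forall y, incl c y -> infinite y.
Proof.
intros H; apply NNPP in H as (s & Hs & Hinj).
destruct (separation (fun t => exists n z, app s n z /\ t ∈ z) x) as [c Hc];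
  [definability|].
assert (Hc' : forall t, t ∈ c <-> exists n z, app s n z /\ t ∈ z).
{ intros t; rewrite Hc; split; [tauto|]; intros (n & z & Hz & Ht).
  split; [apply (app_cod s _ _ n z Hs Hz), Ht|eauto]. }
exists s, c; split; [exact Hs|split; [exact Hc'|split]].
- intros t Ht; apply Hc in Ht; tauto.
- intros y Hcy Hfin; destruct (powerset_exists y) as [q Hq].
  apply (finite_no_omega_injection q (finite_powerset y Hfin q Hq)).
  exists s; split; [|exact Hinj]; apply (fun_codomain s _ _ _ Hs).
  intros n z Hz; apply Hq; intros t Ht; apply Hcy, Hc'; eauto.
Qed.

End Theory.

(** * Assembly of the six clauses *)

Theorem theorem4p3 (M : ZF_model) (X Z A : M)
  (hX : infinite X)
  (hZ : bornology X Z)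
  (hAX : forall x : M, x ∈ A -> power X x)
  (hfinA : forall x : M, finite_subsets X x -> x ∈ A)
  (hAZ : forall x : M, x ∈ A -> x ∈ Z) :
  exists psi : M, is_indicator_map X psi /\
  (bijection psi (power X) (cantor X) /\
   continuous (S_space X Z (power X)) (cantor_space X Z) psi) /\
  ((homeomorphism (S_space X Z (power X)) (cantor_space X Z) psi
      <-> X ∈ Z) /\
   (homeomorphic (S_space X Z (power X)) (cantor_space X Z)
      <-> X ∈ Z)) /\
  (exists psiA : M, is_restriction psiA psi (elts A) /\
     homeomorphism (S_space X Z (elts A))
       (subspace (cantor_space X Z) (cantor_part X (elts A))) psiA) /\
  (exists psiF : M, is_restriction psiF psi (finite_subsets X) /\
     homeomorphism (S_space X Z (finite_subsets X))
       (subspace (cantor_space X Z) (cantor_part X (finite_subsets X)))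
       psiF) /\
  ((forall Y : M, incl Y X -> infinite Y -> ~ dedekind_finite (elts Y)) ->
   (forall x : M, countable_subsets X x -> x ∈ Z) ->
   closed_in (cantor_space X Z) (cantor_part X (finite_subsets X))) /\
  ((forall Y : M, incl Y X -> infinite Y -> ~ quasi_dedekind_finite Y) ->
   sigma_ideal X Z ->
   closed_in (cantor_space X Z) (cantor_part X (finite_subsets X))).
Proof.
destruct hZ as [hid hcover].
destruct (powerset_exists X) as [q Hq].
(* X is infinite, hence has a point, and the bornology covers it. *)
assert (hXZ : exists z : M, z ∈ Z /\ ~ is_empty z).
{ assert (Hne : ~ is_empty X) by (intros H; apply hX, finite_empty, H).
  apply nonempty_elt in Hne as [t Ht].
  destruct (hcover t Ht) as (z & Hz & Htz); exists z; split; [exact Hz|].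
  intros H; exact (H t Htz). }
assert (HXX : forall x : M, power X x -> incl x X) by (intros x Hx; exact Hx).
destruct (graph_exists (is_indicator X) q (power X) (cantor X))
  as (psi & Hpsi & Happ).
{ definability. }
{ exact Hq. }
{ intros x _; apply indicator_exists. }
{ intros x f _ Hf; apply Hf. }
{ intros x f f' _; apply indicator_unique. }
assert (Hbij : bijection psi (power X) (cantor X)).
{ split; [split; [exact Hpsi|]|].
  - intros x x' f Hx Hx'.
    apply Happ in Hx as [Hx Hxf]; apply Happ in Hx' as [Hx' Hxf'].
    exact (indicator_inj X x x' f Hx Hx' Hxf Hxf').
  - intros f Hf; destruct (cantor_indicator X f Hf) as (x & Hx).
    exists x; apply Happ, Hx. }
assert (Hcont : continuous (S_space X Z (power X)) (cantor_space X Z) psi).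
{ split; [exact Hpsi|]; intros V HV.
  destruct (indicator_preimage_open X Z hid q (power X) Hq V HV)
    as (W & HW & H).
  exists W; split; [exact HW|]; intros x; rewrite H.
  split; intros (Hx & f & Hxf & Hf); (split; [exact Hx|]); exists f;
    (split; [|exact Hf]); apply Happ; [split; [exact Hx|exact Hxf]|exact Hxf]. }
(* If X ∈ Z then P(X) ⊆ Z, so [indicator_image_open] applies to the family of all subsets. *)
assert (Hhomeo : X ∈ Z ->
  homeomorphism (S_space X Z (power X)) (cantor_space X Z) psi).
{ intros HXZ; apply homeomorphism_intro; [exact Hbij|exact Hcont|].
  intros V HV.
  destruct (indicator_image_open X Z hid q (power X) Hq HXX hXZ) with (V := V)
    as (U & HU & H).
  - destruct hid as (_ & _ & Hdown & _); intros x; exact (Hdown X x HXZ).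
  - exact HV.
  - exists U; split; [exact HU|]; intros f; split.
    + intros HfU; assert (Hf : cantor X f) by (apply HU; exact HfU).
      split; [exact Hf|].
      destruct (cantor_indicator X f Hf) as (x & Hx & Hxf).
      exists x; split; [apply Happ; split; [exact Hx|exact Hxf]|].
      apply (H x f Hx Hxf), HfU.
    + intros (_ & x & Hxf & HxV); apply Happ in Hxf as [Hx Hxf].
      apply (H x f Hx Hxf), HxV. }
(* Clauses (iii) and (iv) are the instances A and [X]^{<ω} of one statement about families of
   subsets of X included in Z. *)
assert (Hrestr : forall (b : M) (B : M -> Prop), (forall x, x ∈ b <-> B x) ->
  (forall x, B x -> incl x X) -> (forall x, B x -> x ∈ Z) ->
  exists psiB : M, is_restriction psiB psi B /\ homeomorphism (S_space X Z B)
    (subspace (cantor_space X Z) (cantor_part X B)) psiB).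
{ intros b B hb hB hBZ.
  destruct (separation (fun p => exists x y, is_opair p x y /\ x ∈ b) psi)
    as [g Hg]; [definability|].
  assert (Hg' : is_restriction g psi B).
  { intros p; rewrite Hg; split; intros (Hp & x & y & Hxy & Hx);
      (split; [exact Hp|]); exists x, y; (split; [exact Hxy|apply hb, Hx]). }
  exists g; split; [exact Hg'|].
  destruct (restriction_fun psi g _ B _ (cantor_part X B) Hpsi Hg' hB)
    as [Hfun Hgapp].
  - intros x f Hx Hf; apply Happ in Hf as [_ Hf].
    apply (cantor_part_indicator X B f hB); eauto.
  - apply (indicator_map_homeomorphism X Z hid b B hb hB hXZ hBZ g Hfun).
    intros x f; rewrite Hgapp, Happ; split; [tauto|].
    intros [Hx Hf]; split; [exact Hx|split; [exact (hB x Hx)|exact Hf]]. }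
assert (Hfin : exists F : M, forall x, x ∈ F <-> finite_subsets X x).
{ destruct (separation finite q) as [F HF]; [definability|].
  exists F; intros x; rewrite HF, Hq; reflexivity. }
destruct Hfin as [F HF].
exists psi; split; [|split; [|split; [|split; [|split; [|split]]]]].
- split; [exact Hpsi|]; intros x f Hf; apply Happ, Hf.
- split; [exact Hbij|exact Hcont].
- assert (H := homeomorphic_mem X Z hid).
  split; split; intros HXZ.
  + apply H; exists psi; exact HXZ.
  + apply Hhomeo, HXZ.
  + apply H, HXZ.
  + exists psi; apply Hhomeo, HXZ.
- apply (Hrestr A (elts A)); auto; reflexivity.
- apply (Hrestr F (finite_subsets X) HF); [intros x Hx; apply Hx|auto].
- intros HD HC; apply (finite_part_closed X Z hid); intros x Hx Hinf.
  destruct (dedekind_infinite_countable_subset x (HD x Hx Hinf))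
    as (c & Hc & Hcx & H).
  exists c; split; [apply HC; split; [intros t Ht; auto|exact Hc]|auto].
- intros HD [_ HS]; apply (finite_part_closed X Z hid); intros x Hx Hinf.
  destruct (quasi_dedekind_infinite_union x (HD x Hx Hinf))
    as (s & c & Hs & Hc & Hcx & H).
  exists c; split; [|auto].
  apply (HS s); [|exact Hc].
  apply (fun_codomain s _ _ _ Hs); intros n z Hz.
  destruct (app_cod s _ _ n z Hs Hz) as [Hzx Hzfin].
  (* The sequence takes values in Z because [X]^{<ω} ⊆ A ⊆ Z. *)
  apply hAZ, hfinA; split; [intros t Ht; auto|exact Hzfin].
Qed.
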